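(* Let $B$ be a Bratteli diagram of finite rank. Then $B$ is isomorphic to a Bratteli diagram whose incidence matrices $\{F_n\}_{n\ge 1}$ have, for some integers $1\le s\le m$ and with block sizes not depending on $n$, the block lower triangular form $$ F_n =\left( \begin{array}{ccccccc} F_1^{(n)} & 0 & \cdots & 0 & 0 & \cdots & 0 \\ 0 & F_2^{(n)} & \cdots & 0 & 0 & \cdots & 0 \\ \vdots & \vdots & \ddots & \vdots & \vdots & \cdots& \vdots \\ 0 & 0 & \cdots & F_s^{(n)} & 0 & \cdots & 0 \\ X_{s+1,1}^{(n)} & X_{s+1,2}^{(n)} & \cdots & X_{s+1,s}^{(n)} & F_{s+1}^{(n)} & \cdots & 0 \\ \vdots & \vdots & \cdots & \vdots & \vdots & \ddots & \vdots \\ X_{m,1}^{(n)} & X_{m,2}^{(n)} & \cdots & X_{m,s}^{(n)} & X_{m,s+1}^{(n)} & \cdots & F_m^{(n)} \\ \end{array} \right) $$ where, for every $n\ge 1$: the matrices $F_i^{(n)}$, $i=1,\dots,s$, have strictly positive entries; each matrix $F_i^{(n)}$, $i=s+1,\dots,m$, has either all entries strictly positive or all entries zero; and for every $j=s+1,\dots,m$ at least one of the matrices $X_{j,k}^{(n)}$, $k=1,\dots,j-1$, is non-zero.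
   Context: A Bratteli diagram $B=(V,E)$ is an infinite graph with vertex set $V=\bigsqcup_{i\ge 0}V_i$ and edge set $E=\bigsqcup_{i\ge 1}E_i$, where all $V_i,E_i$ are finite, $V_0=\{v_0\}$ is a single point, and there are range and source maps $r,s$ with $r(E_i)=V_i$, $s(E_i)=V_{i-1}$, $s^{-1}(v)\ne\emptyset$ for all $v\in V$ and $r^{-1}(v)\neq\emptyset$ for all $v\in V\setminus V_0$. The $n$-th incidence matrix $F_n=(f^{(n)}_{v,w})$, $n\ge 1$, is the $|V_{n+1}|\times|V_n|$ matrix with $f^{(n)}_{v,w}=|\{e\in E_{n+1}: r(e)=v,\ s(e)=w\}|$. $B$ has finite rank if $\sup_n|V_n|<\infty$. Telescoping $B$ along $0=n_0<n_1<n_2<\cdots$ means passing to the diagram with vertex levels $V_{n_k}$ whose edges between consecutive levels are the finite paths of $B$ between $V_{n_k}$ and $V_{n_{k+1}}$ (so its incidence matrices are $F_{n_{k+1}-1}\cdots F_{n_k}$). Two Bratteli diagrams are isomorphic if they are equivalent under the equivalence relation generated by telescoping and level-preserving graph isomorphism. *)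

(* Defs.v *)
From mathcomp Require Import all_boot all_order all_algebra.
From Stdlib Require Import Relations.

Set Implicit Arguments.
Unset Strict Implicit.
Unset Printing Implicit Defensive.

(* [edge n] is the set usually written E_{n+1}: the edges joining level n to
   level n+1.  The conditions s(E_{n+1}) = V_n and r(E_{n+1}) = V_{n+1} are
   [source_surj] and [range_surj]; disjointness of the levels is implicit in
   the typing. *)
Record bratteli := Bratteli {
  vertex : nat -> finType;
  edge : nat -> finType;
  source : forall n, edge n -> vertex n;
  range : forall n, edge n -> vertex n.+1;
  card_vertex0 : #|vertex 0| = 1;
  source_surj : forall n (v : vertex n), exists e : edge n, source e = v;
  range_surj : forall n (v : vertex n.+1), exists e : edge n, range e = v
}.

Definition finite_rank (B : bratteli) : Prop :=
  exists K : nat, forall n, #|vertex B n| <= K.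

Definition incidence (B : bratteli) (n : nat)
    (v : vertex B n.+1) (w : vertex B n) : nat :=
  #|[set e : edge B n | (range e == v) && (source e == w)]|.

(* The n-th incidence matrix, for given enumerations of its rows (vertices of
   level n+1) and of its columns (vertices of level n). *)
Definition incidence_mx (B : bratteli) (n a b : nat)
    (rowv : 'I_a -> vertex B n.+1) (colv : 'I_b -> vertex B n) : 'M[nat]_(a, b) :=
  \matrix_(i < a, j < b) incidence (rowv i) (colv j).

Record path_space (B : bratteli) (a d : nat) := PathSpace {
  path_sort :> finType;
  path_source : path_sort -> vertex B a;
  path_range : path_sort -> vertex B (d + a)
}.

(* The paths of length d starting at level a, with their endpoints.  A path of
   length d+1 is a path of length d followed by an edge; the level is written
   d + a so that d.+1 + a is convertible to (d + a).+1. *)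
Fixpoint paths (B : bratteli) (a d : nat) : path_space B a d :=
  match d return path_space B a d with
  | 0 => @PathSpace B a 0 (vertex B a) id id
  | d'.+1 =>
      let P := paths B a d' in
      @PathSpace B a d'.+1
        {pe : P * edge B (d' + a) | path_range pe.1 == source pe.2}
        (fun pe => path_source (val pe).1)
        (fun pe => range (val pe).2)
  end.

Definition vertex_cast (B : bratteli) (i j : nat) (eij : i = j)
    (v : vertex B i) : vertex B j := eq_rect i (vertex B) v j eij.

Lemma vertex_cast_surj B i j (eij : i = j) (v : vertex B j) :
  exists u : vertex B i, vertex_cast eij u = v.
Proof. by case: _ / eij v => v; exists v. Qed.

Lemma path_source_surj B a d (v : vertex B a) :
  exists p : paths B a d, path_source p = v.
Proof.
elim: d => [|d [p pv]]; first by exists v.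
have [e ep] := source_surj (path_range p).
have pe : path_range (p, e).1 == source (p, e).2 by rewrite /= ep.
by exists (exist _ (p, e) pe).
Qed.

Lemma path_range_surj B a d (v : vertex B (d + a)) :
  exists p : paths B a d, path_range p = v.
Proof.
elim: d v => [|d IHd] v; first by exists v.
have [e ev] := range_surj v; have [p pe] := IHd (source e).
have ppe : path_range (p, e).1 == source (p, e).2 by rewrite /= pe.
by exists (exist _ (p, e) ppe).
Qed.

Section Telescope.

Variables (B : bratteli) (n : nat -> nat).
Hypotheses (n0 : n 0 = 0) (n_incr : forall k, n k < n k.+1).

Definition tel_edge (k : nat) := paths B (n k) (n k.+1 - n k).

Definition tel_range (k : nat) (p : tel_edge k) : vertex B (n k.+1) :=
  vertex_cast (subnK (ltnW (n_incr k))) (path_range p).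

Lemma tel_card_vertex0 : #|vertex B (n 0)| = 1.
Proof. by rewrite n0 card_vertex0. Qed.

Lemma tel_range_surj k (v : vertex B (n k.+1)) :
  exists p : tel_edge k, tel_range p = v.
Proof.
have [u <-] := vertex_cast_surj (subnK (ltnW (n_incr k))) v.
by have [p <-] := path_range_surj u; exists p.
Qed.

Definition telescope : bratteli :=
  @Bratteli (fun k => vertex B (n k)) (fun k => path_sort (tel_edge k))
    (fun k p => path_source p) tel_range
    tel_card_vertex0 (fun k v => path_source_surj _ v) tel_range_surj.

End Telescope.

Definition graph_iso (B B' : bratteli) : Prop :=
  exists (fV : forall n, vertex B n -> vertex B' n)
         (fE : forall n, edge B n -> edge B' n),
    [/\ forall n, bijective (fV n),
        forall n, bijective (fE n),
        forall n (e : edge B n), source (fE n e) = fV n (source e)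
      & forall n (e : edge B n), range (fE n e) = fV n.+1 (range e)].

Inductive elementary_iso : relation bratteli :=
| Elem_graph_iso B B' : graph_iso B B' -> elementary_iso B B'
| Elem_telescope B n (n0 : n 0 = 0) (n_incr : forall k, n k < n k.+1) :
    elementary_iso B (telescope B n0 n_incr).

Definition isomorphic : relation bratteli :=
  clos_refl_sym_trans bratteli elementary_iso.

Definition positive_mx (a b : nat) (A : 'M[nat]_(a, b)) : Prop :=
  forall i j, 0 < A i j.

(* Main.v *)
(* Restrict to levels with |V_n| constant and identify them with one finite set.
   The supports of the product incidence matrices between levels i < j take
   finitely many values, so by Ramsey's theorem for pairs they equal one fixed
   relation S along a subsequence.  Composing paths over three levels shows that
   S is transitive, so its strongly connected components are either complete or
   irreflexive singletons; since every row of S is nonzero, the terminal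
   components are complete.  Listing the terminal components first and the others
   along the partial order induced by S gives the required form. *)
Require Import Defs.
From mathcomp Require Import all_boot all_order all_algebra.
From Stdlib Require Import ClassicalEpsilon.

Set Implicit Arguments.
Unset Strict Implicit.
Unset Printing Implicit Defensive.

(** * Infinite pigeonhole principle and Ramsey's theorem for pairs *)

Lemma infinite_pigeonhole (C : finType) (f : nat -> C) :
  exists (c : C) (h : nat -> nat),
    (forall k, h k < h k.+1) /\ (forall k, f (h k) = c).
Proof.
(* Otherwise each colour [c] is absent from some [N c] on, and the index [\max_c N c] has no
   possible colour. *)
have [c cP] : exists c, forall N, exists n, (N <= n) && (f n == c).
  apply: NNPP => noc.
  have bounded c : exists N, forall n, N <= n -> f n != c.
    apply: NNPP => unb; apply: noc; exists c => N; apply: NNPP => nex.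
    apply: unb; exists N => n Nn; apply/negP => fnc; apply: nex.
    by exists n; rewrite Nn.
  have [N NP] := fin_all_exists bounded.
  have := NP (f (\max_c N c)) (\max_c N c) (leq_bigmax _).
  by rewrite eqxx.
pose h := fix h k := if k is k'.+1 then ex_minn (cP (h k').+1) else ex_minn (cP 0).
exists c, h; split=> k /=.
  by case: ex_minnP => n /andP[].
by case: k => [|k] /=; case: ex_minnP => n; [move=> /eqP|case/andP=> _ /eqP].
Qed.

(** Thin the sequence repeatedly so that the head of each stage sees all terms of the next stage in
    one colour; the pigeonhole principle on these colours then selects among the heads. *)
Lemma infinite_ramsey (C : finType) (c : nat -> nat -> C) :
  exists (d : C) (h : nat -> nat),
    (forall k, h k < h k.+1) /\ (forall i j, i < j -> c (h i) (h j) = d).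
Proof.
(* [kw] pairs a colour with a selection of indices; [0 < kw.2 0] discards the head, which makes
   successive heads strictly increase. *)
have step (u : nat -> nat) : exists kw : C * (nat -> nat),
    [/\ forall k, kw.2 k < kw.2 k.+1, 0 < kw.2 0
      & forall j, c (u 0) (u (kw.2 j)) = kw.1].
  have [d [w [w_incr wd]]] := infinite_pigeonhole (fun j => c (u 0) (u j.+1)).
  by exists (d, fun j => (w j).+1).
pose kw u := proj1_sig (constructive_indefinite_description _ (step u)).
have kwP u : [/\ forall k, (kw u).2 k < (kw u).2 k.+1, 0 < (kw u).2 0
      & forall j, c (u 0) (u ((kw u).2 j)) = (kw u).1].
  by rewrite /kw; case: constructive_indefinite_description.
pose U n := iter n (fun u => u \o (kw u).2) id.
have U_incr n : {homo U n : i j / i < j}.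
  elim: n => [//|n IHn] i j ij; apply: IHn.
  have [w_incr _ _] := kwP (U n).
  exact: (homo_ltn ltn_trans w_incr).
have U_sub i j x : exists y, U (j + i) x = U i y.
  elim: j x => [|j IHj] x; first by exists x.
  exact: IHj.
have [d [t [t_incr td]]] := infinite_pigeonhole (fun n => (kw (U n)).1).
exists d, (fun n => U (t n) 0); split=> [k|i j ij].
  have U0_incr n : U n 0 < U n.+1 0 by apply: U_incr; case: (kwP (U n)).
  exact: (homo_ltn ltn_trans U0_incr).
have tij : t i < t j := homo_ltn ltn_trans t_incr ij.
(* The later head [U (t j) 0] is a term of stage [(t i).+1], so its colour with [U (t i) 0] is the
   one recorded at stage [t i]. *)
have [y] := U_sub (t i).+1 (t j - (t i).+1) 0.
rewrite subnK // => ->.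
by have [_ _ kwE] := kwP (U (t i)); rewrite -(td i) -(kwE y).
Qed.

(** * Block triangular form of a transitive relation with nonzero rows *)

Section TriangularBlocks.

Variables (T : finType) (S : rel T) (x0 : T).
Hypotheses (S_trans : transitive S) (S_serial : forall x, exists y, S x y).

(** Equality is added because a component may be a single point without a loop. *)
Let equiv x y := (x == y) || (S x y && S y x).
Let down x := [set z | (x == z) || S x z].
Let sink x := [forall y, S x y ==> S y x].
(** Since [equiv] is reflexive, [pick] never falls back on the default, and its choice depends only
    on the class of [x]. *)
Let rep x := odflt x [pick y | equiv x y].

Lemma equiv_sym x y : equiv x y = equiv y x.
Proof. by rewrite /equiv eq_sym andbC. Qed.

Lemma equiv_trans : transitive equiv.
Proof.
move=> y x z /orP[/eqP-> //|/andP[xy yx]] /orP[/eqP<-|/andP[yz zy]].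
  by rewrite /equiv xy yx orbT.
by rewrite /equiv (S_trans xy yz) (S_trans zy yx) orbT.
Qed.

Lemma equiv_rep x : equiv x (rep x).
Proof.
by rewrite /rep; case: pickP => [y //|_] /=; rewrite /equiv eqxx.
Qed.

Lemma rep_equiv x y : (rep x == rep y) = equiv x y.
Proof.
apply/eqP/idP => [xy|xy].
  by apply: equiv_trans (equiv_rep x) _; rewrite xy equiv_sym equiv_rep.
have E z : equiv x z = equiv y z.
  by apply/idP/idP; apply: equiv_trans; rewrite // equiv_sym.
rewrite /rep (eq_pick E); case: pickP => //= /(_ y).
by rewrite /equiv eqxx.
Qed.

Lemma rep_idem x : rep (rep x) = rep x.
Proof. by apply/eqP; rewrite rep_equiv equiv_sym equiv_rep. Qed.

Lemma sinkP x : reflect (forall y, S x y -> S y x) (sink x).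
Proof.
apply: (iffP forallP) => [H y xy|H y]; first exact: implyP (H y) xy.
by apply/implyP/H.
Qed.

Lemma sink_rep x : sink (rep x) = sink x.
Proof.
suff H u v : equiv u v -> sink u -> sink v.
  by apply/idP/idP; apply: H; rewrite ?equiv_rep // equiv_sym equiv_rep.
case/orP=> [/eqP-> //|/andP[uv vu]] /sinkP su; apply/sinkP => z vz.
exact: S_trans (su _ (S_trans uv vz)) uv.
Qed.

(** Transitivity gives the inclusion of down-sets; the point [x] itself is lost. *)
Lemma down_proper x y : S x y -> ~~ S y x -> #|down y| < #|down x|.
Proof.
move=> xy yx; apply: proper_card; apply/properP; split.
  apply/subsetP => z; rewrite !inE => /orP[/eqP<-|yz].
    by rewrite xy orbT.
  by rewrite (S_trans xy yz) orbT.
exists x; rewrite !inE ?eqxx // negb_or yx andbT.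
by apply: contraNneq yx => E; rewrite {1}E -{2}E.
Qed.

Lemma down_rep x : #|down (rep x)| = #|down x|.
Proof.
suff H u v : equiv u v -> down u \subset down v.
  by apply/eqP; rewrite eqn_leq !subset_leq_card //; apply: H;
    rewrite ?equiv_rep // equiv_sym equiv_rep.
case/orP=> [/eqP-> //|/andP[uv vu]]; apply/subsetP => z; rewrite !inE.
case/orP=> [/eqP<-|uz]; first by rewrite vu orbT.
by rewrite (S_trans vu uz) orbT.
Qed.

(** A point with smallest down-set is a sink, as a step without return would shrink that set. *)
Lemma sink_exists : exists x, sink x.
Proof.
case: (arg_minnP (P := predT) (fun x => #|down x|) (i0 := x0) isT) => x _ xmin.
exists x; apply/sinkP => y xy; apply: contraT => yx.
by have := down_proper xy yx; rewrite ltnNge xmin.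
Qed.

Let is_rep x := rep x == x.
(* On non-sinks the size of the down-set is a linear extension of the order on
   components, see [down_proper]. *)
Let sinks := [seq x <- enum T | is_rep x & sink x].
Let sources := sort (fun x y => #|down x| <= #|down y|)
  [seq x <- enum T | is_rep x & ~~ sink x].
Let reps := sinks ++ sources.

Let m := size reps.
Let r (i : 'I_m) := nth x0 reps i.

Lemma mem_reps x : (x \in reps) = is_rep x.
Proof.
rewrite mem_cat mem_sort !(mem_filter _ _ (enum T)) mem_enum !andbT.
by case: is_rep; case: sink.
Qed.

Lemma uniq_reps : uniq reps.
Proof.
rewrite cat_uniq sort_uniq !(filter_uniq _ (enum_uniq T)) andbT /=.
apply/hasPn => x; rewrite mem_sort !(mem_filter _ _ (enum T)) => /andP[/andP[_ nx] _].
by rewrite (negPf nx) andbF.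
Qed.

Lemma sink_r i : sink (r i) = (i < size sinks).
Proof.
rewrite /r nth_cat; case: ltnP => i_s.
  by have := mem_nth x0 i_s; rewrite mem_filter => /andP[/andP[]].
have: i - size sinks < size sources.
  by rewrite ltn_subLR // -size_cat ltn_ord.
by move/(mem_nth x0); rewrite mem_sort mem_filter => /andP[/andP[_ /negPf]].
Qed.

Lemma down_r (i j : 'I_m) : size sinks <= i -> i <= j -> #|down (r i)| <= #|down (r j)|.
Proof.
move=> si ij; have sj := leq_trans si ij.
rewrite /r !nth_cat !ltnNge si sj /=.
apply: (sorted_leq_nth (leT := fun x y => #|down x| <= #|down y|)) => //.
- by move=> y x z; apply: leq_trans.
- by apply: sort_sorted => x y; apply: leq_total.
- by rewrite inE ltn_subLR // -size_cat ltn_ord.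
- by rewrite inE ltn_subLR // -size_cat ltn_ord.
- exact: leq_sub2r.
Qed.

Lemma r_inj : injective r.
Proof.
move=> i j /eqP; rewrite nth_uniq ?uniq_reps ?ltn_ord // => /eqP.
exact: val_inj.
Qed.

Lemma rep_r i : rep (r i) = r i.
Proof. by apply/eqP; have := mem_nth x0 (ltn_ord i); rewrite mem_reps. Qed.

Lemma r_surj x : exists i, rep x = r i.
Proof.
have rx : rep x \in reps by rewrite mem_reps /is_rep rep_idem.
have ix : index (rep x) reps < m by rewrite index_mem.
by exists (Ordinal ix); rewrite /r nth_index.
Qed.

Let size_ i := #|[set x | rep x == r i]|.
(** [tagnat.sig] splits a flat index into a block and a position; [enum_val] reads that position in
    the component of [r i]. *)
Let g (k : 'I_(\sum_i size_ i)) : T := enum_val (tagged (tagnat.sig k)).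

Lemma rep_g i a : rep (g (tagnat.Rank i a)) = r i.
Proof.
rewrite /g /tagnat.Rank tagnat.rankK /=.
by have := enum_valP a; rewrite inE => /eqP.
Qed.

Lemma g_surj i x : rep x = r i -> exists a : 'I_(size_ i), g (tagnat.Rank i a) = x.
Proof.
move=> xi; have xin : x \in [set x | rep x == r i] by rewrite inE xi.
exists (enum_rank_in xin x).
by rewrite /g /tagnat.Rank tagnat.rankK /= enum_rankK_in.
Qed.

Lemma g_bij : bijective g.
Proof.
have surj x : exists k, g k = x.
  have [i xi] := r_surj x; have [a <-] := g_surj xi.
  by exists (tagnat.Rank i a).
have [f fK] := fin_all_exists surj.
exists f => //; apply: inj_can_sym fK _ => k l.
rewrite -(tagnat.sigK k) -(tagnat.sigK l).
case: (tagnat.sig k) (tagnat.sig l) => [i a] [j b] kl.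
(* Equal images have equal representatives, hence the same block, and inside one block [enum_val] is
   injective. *)
have ij : i = j.
  by apply: r_inj; have := rep_g a; rewrite /tagnat.Rank kl rep_g.
case: _ / ij in b kl *.
move: kl; rewrite /g !tagnat.rankK /= => /enum_val_inj-> //.
Qed.

(** The required form for supports only: [P] is the identity for a positive block and negation for a
    zero block. *)
Lemma triangular_blocks :
  exists (m s : nat) (size_ : 'I_m -> nat) (g : 'I_(\sum_i size_ i) -> T),
    let block i j (P : bool -> Prop) :=
      forall a b, P (S (g (tagnat.Rank i a)) (g (tagnat.Rank j b))) in
    [/\ 1 <= s <= m, forall i, 0 < size_ i, bijective g
      & [/\ forall i j : 'I_m, i < j -> block i j (fun b => ~~ b),
            forall i j : 'I_m, i < s -> i != j -> block i j (fun b => ~~ b),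
            forall i : 'I_m, i < s -> block i i id,
            forall i : 'I_m, s <= i -> block i i id \/ block i i (fun b => ~~ b)
          & forall i : 'I_m, s <= i -> exists j : 'I_m, j < i /\
              ~ block i j (fun b => ~~ b)]].
Proof.
have block_equiv i j a b :
    equiv (g (tagnat.Rank i a)) (g (tagnat.Rank j b)) = (i == j).
  by rewrite -rep_equiv !rep_g (inj_eq r_inj).
have block_sink i a : sink (g (tagnat.Rank i a)) = (i < size sinks).
  by rewrite -sink_r -(rep_g a) sink_rep.
have block_down i a : #|down (g (tagnat.Rank i a))| = #|down (r i)|.
  by rewrite -down_rep rep_g.
have block_asym (i j : 'I_m) a b : i != j ->
    S (g (tagnat.Rank i a)) (g (tagnat.Rank j b)) ->
    ~~ S (g (tagnat.Rank j b)) (g (tagnat.Rank i a)).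
  by rewrite -(block_equiv i j a b) negb_or negb_and => /andP[_ /orP[/negPf->|]].
have block_sink0 (i j : 'I_m) a b : i < size sinks -> i != j ->
    ~~ S (g (tagnat.Rank i a)) (g (tagnat.Rank j b)).
  move=> si ij; apply/negP => xy; have := block_asym _ _ _ _ ij xy.
  by rewrite -(block_sink i a) in si; rewrite (sinkP _ si _ xy).
have block_upper (i j : 'I_m) a b : i < j ->
    ~~ S (g (tagnat.Rank i a)) (g (tagnat.Rank j b)).
  move=> ij; have nij : i != j by rewrite -val_eqE neq_ltn ij.
  case: (ltnP i (size sinks)) => si; first exact: block_sink0.
  (* Between distinct components a step has no return, so it would lower the down-set size, against
     the sorting. *)
  apply/negP => xy; have := down_proper xy (block_asym _ _ _ _ nij xy).
  by rewrite !block_down ltnNge down_r // ltnW.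
have block_refl i a b : S (g (tagnat.Rank i b)) (g (tagnat.Rank i b)) ->
    S (g (tagnat.Rank i a)) (g (tagnat.Rank i b)).
  move=> Sb; have := block_equiv i i a b; rewrite eqxx /equiv.
  by case/orP=> [/eqP-> //|/andP[]].
exists m, (size sinks), size_, g => block; split.
- rewrite /m size_cat leq_addr andbT.
  have [x sx] := sink_exists; have: rep x \in sinks.
    by rewrite mem_filter /is_rep rep_idem eqxx sink_rep sx mem_enum.
  by case: sinks.
- by move=> i; apply/card_gt0P; exists (r i); rewrite inE rep_r.
- exact: g_bij.
split.
- by move=> i j ij a b; apply: block_upper.
- by move=> i j si ij a b; apply: block_sink0.
- move=> i si a b; apply: block_refl.
  (* Some step leaves [b], and a sink can return from it, which yields a loop at [b]. *)
  have [z xz] := S_serial (g (tagnat.Rank i b)).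
  rewrite -(block_sink i b) in si.
  exact: S_trans xz (sinkP _ si _ xz).
(* One loop makes the whole component complete, while any step inside a component creates a loop. *)
- move=> i _; case: (boolP [exists b, S (g (tagnat.Rank i b)) (g (tagnat.Rank i b))]).
    case/existsP=> c Sc; left=> a b; apply: (block_refl i).
    have := block_equiv i i b c.
    rewrite eqxx /equiv => /orP[/eqP-> //|/andP[bc cb]].
    exact: S_trans bc cb.
  rewrite negb_exists => /forallP noS; right=> a b; apply/negP => ab.
  have := block_equiv i i a b; rewrite eqxx /equiv.
  case/orP=> [/eqP E|/andP[_ ba]]; first by have := noS a; rewrite {2}E ab.
  by have := noS a; rewrite (S_trans ab ba).
- move=> i si; have [a ai] := g_surj (rep_r i).
  have: ~~ sink (r i) by rewrite sink_r -leqNgt.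
  (* A non-sink has a step to some [y] without return; the block of [y] is the witness, and it
     precedes [i] because upper blocks vanish. *)
  rewrite negb_forall => /existsP[y]; rewrite negb_imply => /andP[xy nyx].
  have [j yj] := r_surj y; have [b bj] := g_surj yj.
  rewrite -ai -bj in xy nyx.
  exists j; split; last by move/(_ a b); rewrite xy.
  rewrite ltn_neqAle leqNgt; apply/andP; split; last first.
    by apply: contraTN xy => /block_upper->.
  rewrite val_eqE; apply: contraNneq nyx => ji; rewrite -ji in a {ai} xy *.
  have := block_equiv j j b a; rewrite eqxx /equiv.
  case/orP=> [/eqP E|/andP[] //]; by rewrite E in xy *.
Qed.

End TriangularBlocks.

(** * Reachability between levels and supports of telescoped incidence matrices *)

Inductive reach (B : bratteli) a (w : vertex B a) : forall b, vertex B b -> Prop :=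
| reach_refl : reach w w
| reach_edge b (e : edge B b) : reach w (source e) -> reach w (range e).

Lemma reach_trans (B : bratteli) a b c
    (w : vertex B a) (u : vertex B b) (v : vertex B c) :
  reach w u -> reach u v -> reach w v.
Proof. by move=> wu; elim=> // d e _; apply: reach_edge. Qed.

Lemma reach_path (B : bratteli) a d (p : paths B a d) :
  reach (path_source p) (path_range p).
Proof.
elim: d p => [|d IHd] p; first exact: reach_refl.
case: p => -[p e] /= /eqP pe; apply: reach_edge.
by rewrite -pe; apply: IHd.
Qed.

Lemma reach_cast (B : bratteli) a b b' (E : b = b')
    (w : vertex B a) (v : vertex B b) :
  reach w v -> reach w (vertex_cast E v).
Proof. by case: _ / E. Qed.

(** [reach] leaves the target level free, so concatenation needs no cast; the cast [E] appears only
    on return to [paths]. *)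
Lemma path_of_reach (B : bratteli) a b (w : vertex B a) (v : vertex B b) :
  reach w v -> exists d (E : d + a = b) (p : paths B a d),
    path_source p = w /\ vertex_cast E (path_range p) = v.
Proof.
elim=> [|{v}c e _ [d [E [p [pw pe]]]]].
  by exists 0, erefl, w.
case: _ / E in e pe *.
have ppe : path_range (p, e).1 == source (p, e).2 by rewrite /= -pe.
by exists d.+1, erefl, (exist _ (p, e) ppe).
Qed.

Lemma reach_surj (B : bratteli) a b (v : vertex B b) :
  a <= b -> exists w : vertex B a, reach w v.
Proof.
move=> ab; have [u <-] := vertex_cast_surj (subnK ab) v.
have [p <-] := path_range_surj u.
by exists (path_source p); apply/reach_cast/reach_path.
Qed.

Lemma incidence_telescope_gt0 (B : bratteli) n (n0 : n 0 = 0)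
    (n_incr : forall k, n k < n k.+1) k
    (v : vertex B (n k.+1)) (w : vertex B (n k)) :
  0 < incidence (B := telescope B n0 n_incr) (n := k) v w <-> reach w v.
Proof.
split=> [/card_gt0P[p]|/path_of_reach[d [E [p [pw pv]]]]].
  rewrite inE => /andP[/eqP<- /eqP<-].
  exact/reach_cast/reach_path.
apply/card_gt0P.
(* The two levels determine the path length, and the level equality is proof-irrelevant, so [E]
   agrees with the cast in [tel_range]. *)
have dE : d = n k.+1 - n k by rewrite -E addnK.
case: _ / (esym dE) in E p pw pv *.
exists p; rewrite inE /= pw eqxx andbT -pv /tel_range.
by rewrite (eq_irrelevance (subnK _) E).
Qed.

Lemma stationary_support (B : bratteli) : finite_rank B ->
  exists (K : nat) (S : rel 'I_K) (h : nat -> nat)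
         (enum_level : forall k, 'I_K -> vertex B (h k)),
    [/\ 0 < h 0, forall k, h k < h k.+1,
        forall k, bijective (enum_level k)
      & forall i j, i < j -> forall x y,
          S x y <-> reach (enum_level i y) (enum_level j x)].
Proof.
case=> N cardN.
(* Starting from level 1 gives [0 < h 0], which leaves room for level 0 in the telescoping. *)
have card_lt n : #|vertex B n.+1| < N.+1 by rewrite ltnS.
have [K [u [u_incr uK]]] := infinite_pigeonhole (fun n => Ordinal (card_lt n)).
have cardK k : #|vertex B (u k).+1| = K by rewrite -(uK k).
pose level k (i : 'I_K) : vertex B (u k).+1 := enum_val (cast_ord (esym (cardK k)) i).
have level_bij k : bijective (level k).
  apply: bij_comp (enum_val_bij _) _.
  by exists (cast_ord (cardK k)); [apply: cast_ordKV | apply: cast_ordK].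
(* Ramsey colours must form a finite type, so the proposition [reach] is decided classically. *)
have [holds holdsP] : exists holds : Prop -> bool, forall P, holds P <-> P.
  exists (fun P => if excluded_middle_informative P then true else false) => P.
  by case: excluded_middle_informative.
have [S [t [t_incr tS]]] := infinite_ramsey
  (fun i j => [ffun xy : 'I_K * 'I_K => holds (reach (level i xy.2) (level j xy.1))]).
exists K, (fun x y => S (x, y)), (fun k => (u (t k)).+1), (fun k => level (t k)).
split=> // [k|i j ij x y]; first by rewrite ltnS (homo_ltn ltn_trans u_incr).
by rewrite -(tS i j ij) ffunE; apply: holdsP.
Qed.

(** * Telescoping to the levels with stationary support *)

Theorem theorem2p6 (B : bratteli) (hB : finite_rank B) :
  exists (B' : bratteli) (m s : nat) (size_ : 'I_m -> nat)
         (vert : forall n, 'I_(\sum_(i < m) size_ i) -> vertex B' n),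
    [/\ isomorphic B B',
        1 <= s <= m,
        forall i, 0 < size_ i,
        forall n, 1 <= n -> bijective (vert n)
      & forall n, 1 <= n ->
          let F := incidence_mx (vert n.+1) (vert n) in
          [/\ forall i j : 'I_m, i < j -> submxblock F i j = 0%R,
              forall i j : 'I_m, i < s -> j < s -> i != j ->
                submxblock F i j = 0%R,
              forall i : 'I_m, i < s -> positive_mx (submxblock F i i),
              forall i : 'I_m, s <= i ->
                positive_mx (submxblock F i i) \/ submxblock F i i = 0%R
            & forall j : 'I_m, s <= j ->
                exists k : 'I_m, k < j /\ submxblock F j k <> 0%R]].
Proof.
have [K [S [h [lev [h0 h_incr lev_bij levS]]]]] := stationary_support hB.
have S_trans : transitive S.
  move=> y x z /(levS 1 2 isT) yx /(levS 0 1 isT) zy.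
  exact/(levS 0 2 isT)/reach_trans/yx.
have S_serial x : exists y, S x y.
  have [w wx] := reach_surj (lev 1 x) (ltnW (h_incr 0)).
  have [f _ fK] := lev_bij 0.
  by exists (f w); apply/(levS 0 1 isT); rewrite fK.
have [v0 _] : exists v0 : vertex B 0, v0 \in predT.
  by apply/card_gt0P; rewrite card_vertex0.
have [x0] : inhabited 'I_K.
  have [p _] := path_source_surj (h 0) v0.
  have [f _ _] := lev_bij 0.
  by apply/inhabits/f/(vertex_cast (addn0 _)); apply: path_range p.
have [m [s [size_ [g [sm size_gt0 g_bij]]]]] :=
  triangular_blocks x0 S_trans S_serial.
move=> [upper_block sink_block sink_diag diag below].
(* Telescoping must keep level 0, so stationary level [k] becomes level [k.+1]; at level 0 the map
   [vert] is only a placeholder. *)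
pose n k := if k is k'.+1 then h k' else 0.
have n_incr k : n k < n k.+1 by case: k.
pose B' := telescope B (erefl : n 0 = 0) n_incr.
pose vert k : 'I_(\sum_(i < m) size_ i) -> vertex B' k :=
  if k is k'.+1 then lev k' \o g else fun _ => v0.
have F_gt0 k i j a b : 0 < k ->
    (0 < submxblock (incidence_mx (vert k.+1) (vert k)) i j a b) =
    S (g (tagnat.Rank i a)) (g (tagnat.Rank j b)).
  case: k => // k _; rewrite !mxE.
  apply/idP/idP => [/incidence_telescope_gt0|].
    by move/(levS k k.+1 (ltnSn k)).
  by move/(levS k k.+1 (ltnSn k)) => ?; apply/incidence_telescope_gt0.
have F_eq0 k i j : 0 < k ->
    (submxblock (incidence_mx (vert k.+1) (vert k)) i j = 0)%R <->
    forall a b, ~~ S (g (tagnat.Rank i a)) (g (tagnat.Rank j b)).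
  move=> k0; split=> [F0 a b|noS]; first by rewrite -(F_gt0 k) // F0 mxE.
  by apply/matrixP => a b; have := noS a b;
    rewrite -(F_gt0 k) // -eqn0Ngt [RHS]mxE => /eqP.
exists B', m, s, size_, vert; split=> //.
- exact/Relation_Operators.rst_step/Elem_telescope.
- by case=> // k _; apply: (bij_comp (lev_bij k) g_bij).
move=> k k0 F; split.
- by move=> i j ij; apply/F_eq0 => //; apply: upper_block.
- by move=> i j si _ ij; apply/F_eq0 => //; apply: sink_block.
- by move=> i si a b; rewrite F_gt0 //; apply: sink_diag.
- move=> i si; case: (diag i si) => diag_i; [left=> a b|right].
    by rewrite F_gt0 //; apply: diag_i.
  exact/F_eq0.
- move=> j sj; have [i [ij Sij]] := below j sj.
  by exists i; split=> // /F_eq0; apply: contra_not Sij; apply.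
Qed.
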